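(* Let $(\mathbb{X},d_{\mathbb{X}})$ be a Polish metric space with bounded diameter, $P_1,P_2\in\mathcal{P}(\mathbb{X})$ and $n\ge1$. Let $X_1,\dots,X_n$ be i.i.d. with law $P_1$ and $Y_1,\dots,Y_n$ be i.i.d. with law $P_2$. Then $$\mathcal{W}_{\mathcal{W}}\bigg(\mathcal{L}\Big(\frac1n\sum_{i=1}^n\delta_{X_i}\Big),\mathcal{L}\Big(\frac1n\sum_{i=1}^n\delta_{Y_i}\Big)\bigg)=\mathcal{W}(P_1,P_2).$$
   Context: $\mathcal{P}(\mathbb{X})$ is the space of Borel probability measures on $\mathbb{X}$ with the weak topology, and $\mathcal{P}(\mathcal{P}(\mathbb{X}))$ the space of Borel probability measures on it. $\mathcal{L}(\cdot)$ denotes the law; here the empirical measures are random elements of $\mathcal{P}(\mathbb{X})$. $\mathcal{W}$ is the Wasserstein distance of order 1 on $\mathcal{P}(\mathbb{X})$: $\mathcal{W}(P_1,P_2)=\inf_{\gamma\in\Gamma(P_1,P_2)}\mathbb{E}_{(Z_1,Z_2)\sim\gamma}(d_{\mathbb{X}}(Z_1,Z_2))$, with $\Gamma$ the set of couplings. The Wasserstein over Wasserstein distance on $\mathcal{P}(\mathcal{P}(\mathbb{X}))$ is $\mathcal{W}_{\mathcal{W}}(\mathbb{Q}_1,\mathbb{Q}_2)=\inf_{\gamma\in\Gamma(\mathbb{Q}_1,\mathbb{Q}_2)}\mathbb{E}_{(\tilde P_1,\tilde P_2)\sim\gamma}(\mathcal{W}(\tilde P_1,\tilde P_2))$. *)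

(* Defs.v *)
From HB Require Import structures.
From mathcomp Require Import all_boot all_order all_algebra.
From mathcomp Require Import all_classical all_reals all_analysis.
From mathcomp Require Import measurable_realfun.

Set Implicit Arguments.
Unset Strict Implicit.
Unset Printing Implicit Defensive.

Import Order.TTheory GRing.Theory Num.Theory.
Import numFieldNormedType.Exports.

Local Open Scope classical_set_scope.
Local Open Scope ring_scope.

HB.mixin Record isSeparable T & Topological T := {
  separable_subproof : exists2 D : set T, countable D & dense D }.

(* Complete separable metric spaces. The base point required by the library's
   measurable types is harmless: a space carrying a probability measure is
   nonempty. *)
#[short(type="polishMetricType")]
HB.structure Definition PolishMetric (R : realType) :=
  { T of Metric R T & Complete T & isSeparable T }.

Definition borel (T : ptopologicalType) := g_sigma_algebraType (@open T).

Section transport.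
Local Open Scope ereal_scope.
Context d (T : measurableType d) (R : realType).

Definition coupling (P1 P2 : probability T R) :
    set (probability (T * T)%type R) :=
  [set g | (forall A, measurable A -> g (fst @^-1` A) = P1 A) /\
           (forall A, measurable A -> g (snd @^-1` A) = P2 A)].

Definition transport_cost (c : T -> T -> \bar R) (P1 P2 : probability T R) :
    \bar R :=
  ereal_inf [set \int[g]_z c z.1 z.2 | g in coupling P1 P2].

End transport.

Section prob_space.
Context (R : realType) (X : polishMetricType R).

Definition bounded_continuous :=
  {f : X -> R | continuous f /\ bounded_fun (f : X -> R^o)}.

Definition test_integral (P : probability (borel X) R) :
    {ptws bounded_continuous -> R} :=
  fun f => \int[P]_x (sval f x).

(* The weak topology is the coarsest one making P |-> \int[P]_x f x continuous
   for every bounded continuous f. Elements of probability (borel X) R that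
   agree on Borel sets but not on all sets are topologically
   indistinguishable, hence not separated by Borel sets of prob. *)
Definition prob := initial_topology test_integral.

HB.instance Definition _ := PointedTopological.on prob.

Definition wasserstein (P1 P2 : probability (borel X) R) : \bar R :=
  transport_cost (fun x y : borel X => (mdist (x : X) (y : X))%:E) P1 P2.

Definition wasserstein_over_wasserstein
    (Q1 Q2 : probability (borel prob) R) : \bar R :=
  transport_cost (fun P1 P2 : borel prob => wasserstein P1 P2) Q1 Q2.

End prob_space.

Section empirical.
Local Open Scope ereal_scope.
Context (R : realType) (X : polishMetricType R) (n : nat).

(* The argument n_gt0 only serves to make this a probability measure. *)
Definition empirical (n_gt0 : (0 < n)%N) (x : 'I_n -> borel X)
    (A : set (borel X)) : \bar R :=
  (n%:R^-1)%:E * \sum_(i < n) \d_(x i) A.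

Context (n_gt0 : (0 < n)%N) (x : 'I_n -> borel X).

Let empirical0 : empirical n_gt0 x set0 = 0.
Proof.
by rewrite /empirical big1 ?mule0// => i _; rewrite measure0.
Qed.

Let empirical_ge0 A : 0 <= empirical n_gt0 x A.
Proof.
by rewrite /empirical mule_ge0 ?lee_fin ?invr_ge0// sume_ge0.
Qed.

Let empirical_sigma_additive : semi_sigma_additive (empirical n_gt0 x).
Proof.
move=> F mF tF mUF; rewrite /empirical.
pose D i : {measure set (borel X) -> \bar R} := \d_(x i).
have -> : (fun m => \sum_(0 <= k < m)
    (n%:R^-1)%:E * \sum_(i < n) D i (F k)) =
  (fun m => (n%:R^-1)%:E * \sum_(i < n) \sum_(0 <= k < m) D i (F k)).
  apply/funext => m; rewrite exchange_big/= -ge0_sume_distrr//.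
  by move=> i _; rewrite sume_ge0.
apply: cvgeZl => //; apply: cvg_nnesum => // i _.
  by apply: nearW => m; rewrite sume_ge0.
exact: measure_semi_sigma_additive.
Qed.

HB.instance Definition _ := isMeasure.Build _ _ _ (empirical n_gt0 x)
  empirical0 empirical_ge0 empirical_sigma_additive.

Let empirical_setT : empirical n_gt0 x [set: borel X] = 1.
Proof.
rewrite /empirical (eq_bigr (fun=> 1)) => [|i _]; last exact: diracT.
rewrite sumEFin sumr_const card_ord -EFinM -mulr_natr mul1r mulVf//.
by rewrite pnatr_eq0 -lt0n.
Qed.

HB.instance Definition _ := Measure_isProbability.Build _ _ _
  (empirical n_gt0 x) empirical_setT.

End empirical.

Section iid.
Local Open Scope ereal_scope.
Context d d' (O : measurableType d) (T : measurableType d') (R : realType).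
Context (mu : probability O R).

Definition mutually_independent (n : nat) (X : 'I_n -> {RV mu >-> T}) :=
  forall (J : {set 'I_n}) (A : 'I_n -> set T),
    (forall i, measurable (A i)) ->
    mu (\bigcap_(i in [set` J]) X i @^-1` A i) =
      \prod_(i in J) mu (X i @^-1` A i).

Definition has_law (X : {RV mu >-> T}) (P : probability T R) :=
  forall A, measurable A -> distribution mu X A = P A.

Definition iid (n : nat) (X : 'I_n -> {RV mu >-> T}) (P : probability T R) :=
  mutually_independent X /\ forall i, has_law (X i) P.

End iid.

Section empirical_rv.
Context (R : realType) (X : polishMetricType R).

Lemma open_mball (x : X) (e : R) : open (ball x e).
Proof.
rewrite openE => y; rewrite ballEmdist/= -subr_gt0 => xy.
apply/nbhs_ballP; exists (e - mdist x y) => //= z.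
rewrite !ballEmdist/= ltrBrDl; apply: le_lt_trans; exact: metric_triangle.
Qed.

Lemma measurable_continuous (f : X -> R) :
  continuous f -> measurable_fun [set: borel X] (f : borel X -> R).
Proof.
move=> /continuousP cf.
apply: (measurability (@RGenOInfty.G R) (RGenOInfty.measurableE R)).
move=> _ [_ [a ->] <-]; rewrite setTI; apply: sub_sigma_algebra.
by apply/cf; rewrite set_itvoy; exact: open_gt.
Qed.

Lemma ge0_integral_empirical (n : nat) (n_gt0 : (0 < n)%N)
    (x : 'I_n -> borel X) (f : borel X -> \bar R) :
  measurable_fun setT f -> (forall x, 0 <= f x)%E ->
  (\int[empirical n_gt0 x]_y f y = (n%:R^-1)%:E * \sum_(i < n) f (x i))%E.
Proof.
move=> mf f0.
have n1 : 0 <= n%:R^-1 :> R by rewrite invr_ge0.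
pose y k : borel X := x (insubd (Ordinal n_gt0) k).
have yE (i : 'I_n) : y i = x i.
  by congr x; apply: val_inj; rewrite val_insubd ltn_ord.
rewrite (eq_measure_integral (mscale (NngNum n1) (msum (fun k => dirac (y k)) n))).
  rewrite ge0_integral_mscale//= ge0_integral_measure_sum//; congr (_ * _)%E.
  by apply: eq_bigr => i _; rewrite integral_dirac// diracT mul1e yE.
move=> A mA _; rewrite /mscale/= /msum/= /empirical; congr (_ * _)%E.
by apply: eq_bigr => i _; rewrite yE.
Qed.

Lemma test_integral_empirical (n : nat) (n_gt0 : (0 < n)%N)
    (x : 'I_n -> borel X) (f : bounded_continuous X) :
  test_integral (empirical n_gt0 x) f = n%:R^-1 * \sum_(i < n) sval f (x i).
Proof.
case: f => f [cf bf]; rewrite /test_integral/= /Rintegral integralE.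
have mf : measurable_fun [set: borel X] (EFin \o (f : borel X -> R)).
  by apply/measurable_EFinP; exact: measurable_continuous.
have posE : ((EFin \o f)^\+)%E = EFin \o (fun y => Num.max (f y) 0).
  by apply/funext => y; rewrite funeposE/= EFin_max.
have negE : ((EFin \o f)^\-)%E = EFin \o (fun y => Num.max (- f y) 0).
  by apply/funext => y; rewrite funenegE/= EFin_max.
rewrite !ge0_integral_empirical//.
- rewrite posE negE !sumEFin -!EFinM -EFinB/= -mulrBr -sumrB; congr (_ * _).
  apply: eq_bigr => i _; case: (leP 0 (f (x i))) => [fx0|/ltW fx0].
    by rewrite max_r ?subr0// oppr_le0.
  by rewrite max_l ?oppr_ge0// sub0r opprK.
- exact: measurable_funeneg.
- exact: measurable_funepos.
Qed.

Section measurable_empirical.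
Context d (O : measurableType d) (mu : probability O R).
Context (n : nat) (n_gt0 : (0 < n)%N) (Xs : 'I_n -> {RV mu >-> borel X}).

Definition empirical_rv (w : O) : borel (prob X) :=
  empirical n_gt0 (fun i => Xs i w).

Lemma empirical_continuous :
  continuous (fun v : 'rV[X]_n =>
    test_integral (empirical n_gt0 (fun i => v ord0 i))).
Proof.
move=> v; have FF : Filter (nbhs v) by exact: nbhs_filter.
apply/cvg_sup.
move=> f U [/= _ [[V /= oV <- /= Vfx]] VU].
pose h (w : 'rV[X]_n) := test_integral (empirical n_gt0 (fun i => w ord0 i)) f.
suff hv : h w @[w --> v] --> h v.
  have hV : nbhs v (h @^-1` V) by apply: hv; exact: open_nbhs_nbhs.
  by apply: (@filterS _ (nbhs v) _ _ _ _ hV) => w Vw; exact: VU.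
rewrite /h.
under eq_fun do rewrite test_integral_empirical.
rewrite test_integral_empirical; apply: cvgM; first exact: cvg_cst.
apply: cvg_big => [|i _]; first by move=> ?; exact: add_continuous.
apply: continuous_comp; last by case: f {Vfx VU h} => f [cf bf]/=; exact: cf.
move=> A /nbhs_ballP[e e0 eA]; apply/nbhs_ballP; exists e => // w [_ vw].
exact: eA.
Qed.

Lemma measurable_empirical_rv : measurable_fun setT empirical_rv.
Proof.
apply: (@measurability _ _ O (borel (prob X)) setT empirical_rv
  (@open (prob X)) erefl).
move=> _ [_ [V oV <-] <-]; rewrite setTI.
pose W := [set v : 'rV[X]_n |
  V (test_integral (empirical n_gt0 (fun i => v ord0 i)))].
have oW : open W by move/continuousP : empirical_continuous; apply.
have [D /countable_injP[f fD] dD] := separable_subproof (s := X).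
pose s m : X := xget point [set y | D y /\ f y = m].
have sf y : D y -> s (f y) = y.
  move=> Dy; rewrite /s; case: xgetP => [z _ [Dz]|/(_ y)[]//].
  by move/fD; apply; rewrite inE.
pose box (p : nat * {ffun 'I_n -> nat}) (i : 'I_n) : set (borel X) :=
  ball (s (p.2 i)) (p.1.+1%:R^-1 : R).
pose F p := if `[< [set v : 'rV[X]_n | forall i, box p i (v ord0 i)] `<=` W >]
  then \bigcap_i Xs i @^-1` box p i else set0.
suff -> : empirical_rv @^-1` (test_integral (X:=X) @^-1` V) = \bigcup_p F p.
  apply: countable_bigcupT_measurable => // p; rewrite /F.
  case: ifPn => // _; apply: fin_bigcap_measurable => // i _.
  rewrite -[X in measurable X]setTI; apply: measurable_funP => //.
  apply: sub_sigma_algebra; exact: open_mball.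
have rowE w : (fun i => (\row_i Xs i w) ord0 i) = (fun i => Xs i w).
  by apply/funext => i; rewrite mxE.
apply/seteqP; split => [w Vw|w [p _]].
  have Ww : W (\row_i Xs i w).
    by rewrite /W/= rowE.
  have [e /= e0 eW] : nbhs_ball (\row_i Xs i w : 'rV[X]_n) W.
    by apply/nbhs_ballP; exact: open_nbhs_nbhs.
  pose k := Num.truncn (2 / e).
  have ke : k.+1%:R^-1 + k.+1%:R^-1 <= e.
    rewrite -mulr2n -[leLHS]mulr_natl ler_pdivrMr ?ltr0Sn// -ler_pdivrMl//.
    by rewrite mulrC ltW// Num.Theory.truncnS_gt.
  have k0 : 0 < k.+1%:R^-1 :> R by rewrite invr_gt0.
  have /choice[y yP] (i : 'I_n) : exists y, D y /\ ball (Xs i w : X) k.+1%:R^-1 y.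
    have [] := dD (ball (Xs i w : X) k.+1%:R^-1).
    - by exists (Xs i w); exact: ballxx.
    - exact: open_mball.
    - by move=> y [? ?]; exists y.
  exists (k, [ffun i => f (y i)]) => //; rewrite /F ifT.
    move=> i _; rewrite /box/= ffunE (sf _ (yP i).1).
    exact: (ball_sym (yP i).2).
  apply/asboolP => v vP; apply: eW; split => // a i; rewrite ord1 mxE.
  apply: le_ball ke _ _; apply: ball_triangle (yP i).2 _.
  by have := vP i; rewrite /box/= ffunE (sf _ (yP i).1).
rewrite /F; case: ifPn => // /asboolP pW wF.
have := pW (\row_i Xs i w); rewrite /W/= rowE.
by apply => i; rewrite mxE; exact: wF.
Qed.

HB.instance Definition _ :=
  isMeasurableFun.Build _ _ _ _ empirical_rv measurable_empirical_rv.

Definition empirical_law : probability (borel (prob X)) R :=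
  distribution mu empirical_rv.

End measurable_empirical.
End empirical_rv.

(* Main.v *)
Require Import Defs.
From mathcomp Require Import all_boot all_order all_algebra.
From mathcomp Require Import all_classical all_reals all_analysis.
From mathcomp Require Import measurable_realfun.
From mathcomp Require Import ring lra.

(** The inequality [<=] transports couplings. If [g] couples [P1] and [P2], draw
    [n] independent pairs [(X'_i, Y'_i)] with law [g]. The two empirical
    measures of the coordinates have the prescribed laws, because the law of an
    empirical measure of an i.i.d. sample is determined by [n] and the common
    law of the sample ([empirical_law_unique]). Matching [X'_i] with [Y'_i]
    bounds their distance by the mean of the [d(X'_i, Y'_i)], whose expectation
    is the cost of [g] ([wow_empirical_le]).

    The inequality [>=] says that an empirical measure has mean [P_i] and that
    [W] is jointly convex. A direct proof of convexity would select optimal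
    couplings measurably. Kantorovich-Rubinstein duality avoids this: for a
    1-Lipschitz [f >= 0] and a coupling [G] of the two empirical laws,
      [int f dP1 - int f dP2 = int (int f dp1 - int f dp2) dG(p1, p2)
         <= int W(p1, p2) dG(p1, p2)],
    and duality says that if every 1-Lipschitz [f >= 0] satisfies
    [int f dP1 - int f dP2 <= D], then [W(P1, P2) <= D]
    ([kantorovich_rubinstein]).

    Duality is reduced to a finite transport problem. A separable space of
    bounded diameter is mapped by a measurable [t] to finitely many points, with
    a small mean displacement under both measures ([quantisation]). The finite
    problem is a linear programme whose duality is Farkas' lemma
    ([finite_transport_duality]). A finite optimal plan is spread over the cells
    of [t] by using the product measure inside each pair of cells
    ([coupling_of_cells]), and a finite dual solution is extended to a
    1-Lipschitz function on the whole space as a finite minimum of functions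
    [d(x, s_i) - v_i].

    Measurability of [W] on pairs of measures is avoided throughout: the
    integral of a nonnegative function is a supremum over the simple functions
    below it, hence monotone without any measurability, and it can only increase
    when a pushforward is pulled back ([ge0_le_integral_nonmeasurable],
    [le_integral_pushforward]). *)

Set Implicit Arguments.
Unset Strict Implicit.
Unset Printing Implicit Defensive.

Import Order.TTheory GRing.Theory Num.Theory.
Import numFieldNormedType.Exports.

Local Open Scope classical_set_scope.
Local Open Scope ring_scope.

(** * Farkas' lemma and finite transport duality *)

(** Bartl's induction on the number of inequalities. If the last inequality
    matters, some [x0] violates the conclusion while satisfying all the others,
    so [a ord_max x0 > 0]; every form is then replaced by its composition with
    the projection along [x0] onto the kernel of the last form, where the
    remaining inequalities suffice. *)
Lemma farkas_ord (R : realFieldType) (V : lmodType R) (m : nat)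
    (a : 'I_m -> V -> R) (c : V -> R) :
  (forall i, scalar (a i)) -> scalar c ->
  (forall x, (forall i, a i x <= 0) -> c x <= 0) ->
  exists2 l : 'I_m -> R, (forall i, 0 <= l i) &
    forall x, c x = \sum_i l i * a i x.
Proof.
elim: m a c => [|m IH] a c la lc ac.
  exists (fun=> 0) => // x; rewrite big_ord0; apply/eqP.
  rewrite eq_le ac//=; last by case.
  have := lc (-1) x 0; rewrite addr0 scaleN1r mulN1r.
  have -> : c 0 = 0.
    have := lc 1 0 0; rewrite scale1r addr0 mul1r => /eqP.
    by rewrite -subr_eq0 opprD addNKr oppr_eq0 => /eqP.
  rewrite addr0 => cN; rewrite -oppr_le0 -cN ac//; by case.
pose w := widen_ord (leqnSn m).
have [ac'|] :=
  pselect (forall x, (forall i : 'I_m, a (w i) x <= 0) -> c x <= 0).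
  have [l l0 cE] := IH (fun i => a (w i)) c (fun i => la (w i)) lc ac'.
  exists (fun i => oapp l 0 (insub (val i))) => [i|x].
    by case: insubP => /=.
  rewrite big_ord_recr/= insubF ?ltnn// mul0r addr0 cE.
  apply: eq_bigr => i _; congr (_ * _).
  by rewrite valK.
move=> /existsNP[x0 /not_implyP[ax0 /negP]]; rewrite -ltNge => cx0.
have amx0 : 0 < a ord_max x0.
  rewrite ltNge; apply/negP => am0.
  have : c x0 <= 0.
    apply: ac => i; have [im|im] := ltnP i m.
      have := ax0 (Ordinal im); rewrite (_ : w _ = i)//; exact: val_inj.
    rewrite (_ : i = ord_max)//; apply: val_inj => /=.
    by apply/eqP; rewrite eqn_leq im -ltnS ltn_ord.
  by rewrite leNgt cx0.
set s := a ord_max x0 in amx0.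
have sN0 : s != 0 by rewrite gt_eqF.
pose pr (f : V -> R) x := f x - f x0 / s * a ord_max x.
have lpr f : scalar f -> scalar (pr f).
  by move=> lf k u v; rewrite /pr lf la; ring.
have prE f x : scalar f -> pr f x = f ((- (a ord_max x / s)) *: x0 + x).
  by move=> lf; rewrite lf /pr; field.
(* The hypothesis is applied to projections along x0: the last form vanishes
   there, so the other inequalities are enough. *)
have [l l0 cE] : exists2 l : 'I_m -> R, (forall i, 0 <= l i) &
    forall x, pr c x = \sum_i l i * pr (a (w i)) x.
  apply: IH => [i||x ax]; [exact/lpr/la|exact: lpr|].
  rewrite prE//; apply: ac => i; have [im|im] := ltnP i m.
    have := ax (Ordinal im); rewrite prE// (_ : w _ = i)//; exact: val_inj.
  rewrite (_ : i = ord_max); last first.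
    by apply: val_inj => /=; apply/eqP; rewrite eqn_leq im -ltnS ltn_ord.
  by rewrite la -/s mulNr divfK// addNr.
(* The coefficient of the last form compensates the projection along x0. *)
pose lm := (c x0 - \sum_i l i * a (w i) x0) / s.
exists (fun i => oapp l lm (insub (val i))) => [i|x].
  case: insubP => //= _; rewrite /lm divr_ge0 ?(ltW amx0)// subr_ge0.
  rewrite (le_trans _ (ltW cx0))// -oppr_ge0 -sumrN sumr_ge0// => j _.
  by rewrite -mulrN mulr_ge0// oppr_ge0.
rewrite big_ord_recr/= insubF ?ltnn//=.
rewrite (eq_bigr (fun i => l i * a (w i) x)); last first.
  move=> i _; congr (_ * _); by rewrite valK.
have := cE x; rewrite /pr => /(canRL (subrK _)) ->.
rewrite (eq_bigr (fun i =>
  l i * a (w i) x - l i * a (w i) x0 * (a ord_max x / s))).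
  by rewrite sumrB -mulr_suml /lm; field.
by move=> i _; field.
Qed.

Lemma farkas (R : realFieldType) (V : lmodType R) (J : finType)
    (a : J -> V -> R) (c : V -> R) :
  (forall j, scalar (a j)) -> scalar c ->
  (forall x, (forall j, a j x <= 0) -> c x <= 0) ->
  exists2 l : J -> R, (forall j, 0 <= l j) &
    forall x, c x = \sum_j l j * a j x.
Proof.
move=> la lc ac.
have [x ax|l l0 cE] :=
  @farkas_ord R V #|J| (fun i => a (enum_val i)) c (fun i => la _) lc.
- by apply: ac => j; rewrite -(enum_rankK j).
exists (fun j => l (enum_rank j)) => // x.
rewrite cE [RHS]big_enum_val/=; apply: eq_bigr => i _.
by rewrite enum_valK.
Qed.

(** Farkas' lemma for the cone [f i + g j <= s * c i j], [0 <= s], in the space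
    of triples [(f, g, s)]: the coordinate [s] homogenises the dual problem, and
    the multipliers of the inequalities indexed by [(i, j)] form the plan. *)
Lemma finite_transport_duality (R : realFieldType) (I : finType)
    (a b : I -> R) (c : I -> I -> R) (t : R) :
  (forall i, 0 <= a i) -> (forall i, 0 <= b i) ->
  \sum_i a i = 1 -> \sum_i b i = 1 ->
  (forall f g : I -> R, (forall i j, f i + g j <= c i j) ->
     \sum_i f i * a i + \sum_j g j * b j <= t) ->
  exists p : I -> I -> R, [/\ forall i j, 0 <= p i j,
    forall i, \sum_j p i j = a i, forall j, \sum_i p i j = b j &
    \sum_i \sum_j c i j * p i j <= t].
Proof.
move=> a0 b0 a1 b1 dual.
pose V := ({ffun I -> R^o} * {ffun I -> R^o} * R^o)%type.
pose al (k : option (I * I)) (v : V) : R :=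
  if k is Some (i, j) then v.1.1 i + v.1.2 j - v.2 * c i j else - v.2.
pose ga (v : V) : R :=
  \sum_i v.1.1 i * a i + \sum_j v.1.2 j * b j - v.2 * t.
have lal k : scalar (al k).
  by move=> z u v; case: k => [[i j]|] /=; rewrite ?ffunE /GRing.scale/=; ring.
have lga : scalar ga.
  move=> z u v; rewrite /ga/=.
  under eq_bigr do rewrite !ffunE /GRing.scale/= mulrDl -mulrA.
  under [X in _ + X - _]eq_bigr do rewrite !ffunE /GRing.scale/= mulrDl -mulrA.
  by rewrite !big_split/= -!mulr_sumr /GRing.scale/=; ring.
have [v alv|l l0 gaE] := farkas lal lga.
  case: v alv => [[f g] s] alv; rewrite /ga/=.
  have s0 : 0 <= s by have := alv None; rewrite /= oppr_le0.
  have {}alv i j : f i + g j <= s * c i j.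
    by have := alv (Some (i, j)); rewrite /= subr_le0.
  (* For s > 0 rescaling gives a dual solution; for s = 0 the inequality
     follows by averaging f i + g j <= 0 against the weights a i * b j. *)
  move: s0; rewrite le_eqVlt => /predU1P[s0|s0]; last first.
    have := dual (fun i => s^-1 * f i) (fun i => s^-1 * g i).
    have -> : \sum_i s^-1 * f i * a i + \sum_j s^-1 * g j * b j =
      s^-1 * (\sum_i f i * a i + \sum_j g j * b j).
      rewrite mulrDr !mulr_sumr.
      by congr (_ + _); apply: eq_bigr => i _; rewrite mulrA.
    rewrite ler_pdivrMl// subr_le0; apply => i j.
    by rewrite -mulrDr ler_pdivrMl.
  rewrite -s0 mul0r subr0.
  have -> : \sum_i f i * a i + \sum_j g j * b j =
    \sum_i \sum_j a i * b j * (f i + g j).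
    rewrite -[X in X + _](mulr1 _) -b1 -[X in _ + X]mul1r -a1 !mulr_suml -big_split.
    apply: eq_bigr => i _; rewrite !mulr_sumr -big_split; apply: eq_bigr => j _ /=.
    by ring.
  apply: sumr_le0 => i _; apply: sumr_le0 => j _.
  by apply: mulr_ge0_le0; [exact: mulr_ge0|have := alv i j; rewrite -s0 mul0r].
have gaE' v : ga v =
    \sum_i \sum_j l (Some (i, j)) * (v.1.1 i + v.1.2 j - v.2 * c i j)
    - l None * v.2.
  rewrite gaE (bigD1 None)//= mulrN addrC; congr (_ + _).
  rewrite pair_big/= (reindex_omap Some id)/=; last by case.
  by apply: eq_big => [[i j]|[i j] _]; rewrite ?eqxx.
exists (fun i j => l (Some (i, j))); split => //.
(* The three conclusions are read off by evaluating the identity of linear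
   forms at the basis vectors of each of the three factors. *)
- move=> i; have := gaE' ([ffun k => (k == i)%:R], 0, 0); rewrite /ga/=.
  rewrite mul0r mulr0 !subr0 (bigD1 i)//= big1 ?addr0; last first.
    by move=> k ki; rewrite ffunE (negbTE ki) mul0r.
  rewrite big1 ?addr0; last by move=> k _; rewrite ffunE mul0r.
  rewrite ffunE eqxx mul1r => ->.
  rewrite [RHS](bigD1 i)//= [X in _ = _ + X]big1 ?addr0; last first.
    move=> k ki; apply: big1 => j _.
    by rewrite !ffunE (negbTE ki) mul0r addr0 subr0 mulr0.
  by apply: eq_bigr => j _; rewrite !ffunE eqxx mul0r addr0 subr0 mulr1.
- move=> j; have := gaE' (0, [ffun k => (k == j)%:R], 0); rewrite /ga/=.
  rewrite mul0r mulr0 !subr0 addrC (bigD1 j)//= big1 ?addr0; last first.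
    by move=> k ki; rewrite ffunE (negbTE ki) mul0r.
  rewrite big1 ?addr0; last by move=> k _; rewrite ffunE mul0r.
  rewrite ffunE eqxx mul1r exchange_big/= => ->.
  rewrite [RHS](bigD1 j)//= [X in _ = _ + X]big1 ?addr0; last first.
    move=> k ki; apply: big1 => i _.
    by rewrite !ffunE (negbTE ki) mul0r addr0 subr0 mulr0.
  by apply: eq_bigr => i _; rewrite !ffunE eqxx mul0r add0r subr0 mulr1.
- have := gaE' (0, 0, 1).
  have -> : ga (0, 0, 1) = - t.
    by rewrite /ga/= !big1 ?mul1r ?addr0 ?sub0r// => i _; rewrite ffunE mul0r.
  under eq_bigr do under eq_bigr do rewrite /= !ffunE add0r sub0r mul1r mulrN mulrC.
  under eq_bigr do rewrite sumrN.
  rewrite sumrN mulr1 => /eqP; rewrite -opprD eqr_opp => /eqP ->.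
  by rewrite lerDl.
Qed.

(** * Integrals and couplings *)

Section integration.
Local Open Scope ereal_scope.
Context (R : realType).

Import HBNNSimple.

(** Enlarging the function enlarges the set of simple functions below it. The
    upper function will be a Wasserstein distance between random measures. *)
Lemma ge0_le_integral_nonmeasurable d (T : measurableType d)
    (mu : {measure set T -> \bar R}) (f g : T -> \bar R) :
  (forall x, 0 <= f x) -> (forall x, f x <= g x) ->
  \int[mu]_x f x <= \int[mu]_x g x.
Proof.
move=> f0 fg; rewrite !ge0_integralTE// => [|x]; last exact: le_trans (fg x).
apply: le_ereal_sup => _ [h hf <-]; exists h => // x.
exact: le_trans (fg x).
Qed.

(** Only an inequality: a simple function below [f \o phi] need not factor
    through [phi]. *)
Lemma le_integral_pushforward d d' (T : measurableType d)
    (S : measurableType d') (phi : T -> S) (mphi : measurable_fun setT phi)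
    (mu : {measure set T -> \bar R}) (f : S -> \bar R) :
  (forall y, 0 <= f y) ->
  \int[pushforward mu phi]_y f y <= \int[mu]_x f (phi x).
Proof.
move=> f0; rewrite [leLHS]ge0_integralTE//=; apply: ge_ereal_sup => _ [h hf <-].
rewrite -integralT_nnsfun ge0_integral_pushforward//; last 2 first.
- by apply/measurable_EFinP; exact: measurable_funP.
- by move=> y _; rewrite lee_fin; exact: fun_ge0.
apply: ge0_le_integral_nonmeasurable => [x|x]; last exact: hf.
by rewrite lee_fin; exact: fun_ge0.
Qed.

Lemma integral_finite_range d (T : measurableType d) (I : finType)
    (mu : {measure set T -> \bar R}) (t : T -> I) (phi : I -> \bar R) :
  (forall i, measurable (t @^-1` [set i])) -> (forall i, 0 <= phi i) ->
  \int[mu]_x phi (t x) = \sum_i phi i * mu (t @^-1` [set i]).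
Proof.
move=> mt phi0.
transitivity (\int[mu]_x \sum_i phi i * (\1_(t @^-1` [set i]) x)%:E).
  apply: eq_integral => x _; rewrite (bigD1 (t x))//= big1 ?adde0.
    by rewrite indicE mem_set//= mule1.
  move=> i ix; rewrite indicE memNset ?mule0//= => /eqP.
  by rewrite eq_sym (negbTE ix).
rewrite ge0_integral_sum//; last 2 first.
- move=> i; apply: emeasurable_funM; first exact: measurable_cst.
  by apply/measurable_EFinP; exact: measurable_indic.
- by move=> i x _; rewrite mule_ge0// lee_fin.
apply: eq_bigr => i _; rewrite ge0_integralZl//.
  by rewrite integral_indic// setIT.
by apply/measurable_EFinP; exact: measurable_indic.
Qed.

(** [integral_finite_range] for the constant 1 and the restriction of [mu] to
    [A]. *)
Lemma measure_finite_partition d (T : measurableType d) (I : finType)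
    (mu : {measure set T -> \bar R}) (t : T -> I) (A : set T) :
  (forall i, measurable (t @^-1` [set i])) -> measurable A ->
  mu A = \sum_i mu (A `&` t @^-1` [set i]).
Proof.
move=> mt mA.
have := @integral_finite_range _ _ _ (mrestr mu mA) t (fun=> 1) mt (fun=> lee01).
rewrite integral_cst// mul1e => muA; rewrite -(setTI A) [LHS]muA setTI.
by apply: eq_bigr => i _; rewrite mul1e setIC.
Qed.

(** Wraps a measure of total mass 1, such as a finite mixture, into the bundled
    type over which couplings range. *)
Lemma measure_is_probability d (T : measurableType d)
    (mu : {measure set T -> \bar R}) : mu setT = 1 ->
  exists P : probability T R, P = mu :> (set T -> \bar R).
Proof.
move=> mu1.
exists (mnormalize mu (dirac (point : T))); apply/funext => A.
by rewrite /= /mnormalize mu1 onee_eq0/= invr1 mule1.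
Qed.

Lemma integral_coupling_fst d (T : measurableType d) (P1 P2 : probability T R)
    (g : probability (T * T)%type R) (f : T -> \bar R) :
  coupling P1 P2 g -> measurable_fun setT f -> (forall x, 0 <= f x) ->
  \int[g]_z f z.1 = \int[P1]_x f x.
Proof.
move=> [gl _] mf f0.
rewrite -(@ge0_integral_pushforward _ _ _ _ _ fst measurable_fst g setT)//.
apply: eq_measure_integral => A mA _; exact: gl.
Qed.

Lemma integral_coupling_snd d (T : measurableType d) (P1 P2 : probability T R)
    (g : probability (T * T)%type R) (f : T -> \bar R) :
  coupling P1 P2 g -> measurable_fun setT f -> (forall x, 0 <= f x) ->
  \int[g]_z f z.2 = \int[P2]_x f x.
Proof.
move=> [_ gr] mf f0.
rewrite -(@ge0_integral_pushforward _ _ _ _ _ snd measurable_snd g setT)//.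
apply: eq_measure_integral => A mA _; exact: gr.
Qed.

End integration.

(** * Couplings from finite plans *)

Section gluing.
Local Open Scope ereal_scope.
Context d (T : measurableType d) (R : realType).

(** Any finite plan between the cell masses lifts to a coupling: on the product
    of the cells [i] and [j], take the independent coupling
    [P1 \x P2] rescaled to have mass [p i j]. *)
Lemma coupling_of_cells (P1 P2 : probability T R) (N : nat) (t : T -> 'I_N.+1)
    (p : 'I_N.+1 -> 'I_N.+1 -> R) :
  (forall i, measurable (t @^-1` [set i])) -> (forall i j, 0 <= p i j)%R ->
  (forall i, (\sum_j p i j)%:E = P1 (t @^-1` [set i])) ->
  (forall j, (\sum_i p i j)%:E = P2 (t @^-1` [set j])) ->
  exists2 g : probability (T * T)%type R, coupling P1 P2 g &
    forall i j, g ((t @^-1` [set i]) `*` (t @^-1` [set j])) = (p i j)%:E.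
Proof.
move=> mt p0 pl pr.
pose C i := t @^-1` [set i].
have mCi i : measurable (C i) by exact: mt.
pose a i := (\sum_j p i j)%R; pose b j := (\sum_i p i j)%R.
have p_a i j : a i = 0%R -> p i j = 0%R.
  move/eqP; rewrite psumr_eq0// => /allP/(_ j).
  by rewrite mem_index_enum => /(_ isT)/eqP.
have p_b i j : b j = 0%R -> p i j = 0%R.
  move/eqP; rewrite psumr_eq0// => /allP/(_ i).
  by rewrite mem_index_enum => /(_ isT)/eqP.
have a0 i : (0 <= a i)%R by rewrite sumr_ge0//.
have b0 j : (0 <= b j)%R by rewrite sumr_ge0//.
(* Null cells cause no trouble: there the inverse is 0, and so is p i j. *)
have w0 i j : (0 <= p i j / (a i * b j))%R.
  by rewrite divr_ge0// mulr_ge0// ?a0 ?b0.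
have mC i j : measurable (C i `*` C j) by exact: measurableX.
pose m : {measure set (T * T) -> \bar R} :=
  msum (fun k => msum (fun l =>
    mscale (NngNum (w0 (inord k) (inord l)))
      (mrestr (P1 \x P2) (mC (inord k) (inord l)))) N.+1) N.+1.
have mE A B : measurable A -> measurable B -> m (A `*` B) =
    \sum_i \sum_j ((p i j / (a i * b j))%:E * (P1 (A `&` C i) * P2 (B `&` C j))).
  move=> mA mB; rewrite /m/= /msum/=; apply: eq_bigr => i _.
  rewrite /msum/=; apply: eq_bigr => j _.
  rewrite /mscale/= !inord_val /mrestr/= -setXI.
  by rewrite product_measure1E//; exact: measurableI.
have PC1 i : P1 (C i) = (a i)%:E by rewrite -pl.
have PC2 j : P2 (C j) = (b j)%:E by rewrite -pr.
have PC1_le i A : measurable A ->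
    exists2 q, P1 (A `&` C i) = q%:E & (0 <= q <= a i)%R.
  move=> mA; have mAC : measurable (A `&` C i) by exact: measurableI.
  exists (fine (P1 (A `&` C i))); first by rewrite fineK// fin_num_measure.
  rewrite fine_ge0//= -lee_fin fineK ?fin_num_measure// -PC1.
  by apply: le_measure; rewrite ?inE.
have PC2_le j B : measurable B ->
    exists2 q, P2 (B `&` C j) = q%:E & (0 <= q <= b j)%R.
  move=> mB; have mBC : measurable (B `&` C j) by exact: measurableI.
  exists (fine (P2 (B `&` C j))); first by rewrite fineK// fin_num_measure.
  rewrite fine_ge0//= -lee_fin fineK ?fin_num_measure// -PC2.
  by apply: le_measure; rewrite ?inE.
have m_fst A : measurable A -> m (A `*` setT) = P1 A.
  move=> mA; rewrite mE//= (measure_finite_partition P1 mt mA).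
  apply: eq_bigr => i _; rewrite -/(C i).
  have [q qE /andP[q0 qa]] := PC1_le i A mA.
  rewrite [RHS]qE.
  under eq_bigr do rewrite setTI PC2 qE -!EFinM.
  rewrite sumEFin; congr EFin.
  have [ai|ai] := eqVneq (a i) 0%R.
    have -> : q = 0%R by apply/le_anti; rewrite q0 -ai qa.
    by apply: big1 => j _; rewrite mul0r mulr0.
  transitivity (\sum_j p i j * (q / a i))%R.
    apply: eq_bigr => j _; have [bj|bj] := eqVneq (b j) 0%R.
      by rewrite (p_b _ _ bj) !mul0r.
    by field; rewrite ai bj.
  by rewrite -mulr_suml mulrCA divff// mulr1.
have m_snd B : measurable B -> m (setT `*` B) = P2 B.
  move=> mB; rewrite mE//= (measure_finite_partition P2 mt mB) exchange_big/=.
  apply: eq_bigr => j _; rewrite -/(C j).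
  have [q qE /andP[q0 qb]] := PC2_le j B mB.
  rewrite [RHS]qE.
  under eq_bigr do rewrite setTI PC1 qE -!EFinM.
  rewrite sumEFin; congr EFin.
  have [bj|bj] := eqVneq (b j) 0%R.
    have -> : q = 0%R by apply/le_anti; rewrite q0 -bj qb.
    by apply: big1 => i _; rewrite !mulr0.
  transitivity (\sum_i p i j * (q / b j))%R.
    apply: eq_bigr => i _; have [ai|ai] := eqVneq (a i) 0%R.
      by rewrite (p_a _ _ ai) !mul0r.
    by field; rewrite ai bj.
  by rewrite -mulr_suml mulrCA divff// mulr1.
have [g gE] : exists g : probability (T * T)%type R,
    g = m :> (set (T * T) -> \bar R).
  by apply: measure_is_probability; rewrite -setXTT m_fst// probability_setT.
exists g => [|i j].
  split => [A mA|B mB]; rewrite gE.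
    by rewrite -m_fst//; congr (m _); apply/seteqP; split => [[x y]|[x y] []].
  by rewrite -m_snd//; congr (m _); apply/seteqP; split => [[x y]|[x y] []].
rewrite gE mE// (bigD1 i)//= (bigD1 j)//= !big1 ?adde0.
- rewrite !setIid PC1 PC2 -!EFinM; congr EFin.
  have [bj|bj] := eqVneq (b j) 0%R; first by rewrite (p_b _ _ bj) !mul0r.
  have [ai|ai] := eqVneq (a i) 0%R; first by rewrite (p_a _ _ ai) !mul0r.
  by field; rewrite ai bj.
- move=> k ki; apply: big1 => l _.
  rewrite (_ : _ `&` C k = set0) ?measure0 ?mul0e ?mule0//.
  by rewrite -subset0 /C => x [/= -> ik]; rewrite ik eqxx in ki.
- move=> l lj.
  rewrite (_ : _ `&` C l = set0) ?measure0 ?mule0//.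
  by rewrite -subset0 /C => x [/= -> jl]; rewrite jl eqxx in lj.
Qed.

End gluing.

(** * Measurability of the distance and quantisation *)

Section polish.
Context (R : realType) (X : polishMetricType R).
Implicit Types (x y : X) (P : probability (borel X) R).

Lemma dense_sequence : exists s : nat -> X,
  forall x e, 0 < e -> exists k, mdist (s k) x < e.
Proof.
have [D /countable_injP[f fD] dD] := separable_subproof (s := X).
pose s m : X := xget point [set y | D y /\ f y = m].
exists s => x e e0.
have [||y [xy Dy]] := dD (ball x e).
- by exists x; exact: ballxx.
- exact: open_mball.
exists (f y); have -> : s (f y) = y.
  rewrite /s; case: xgetP => [z _ [Dz]|/(_ y)[]//].
  by move/fD; apply; rewrite inE.
by move: xy; rewrite ballEmdist/= metric_sym.
Qed.

(** The 1-Lipschitz functions; by symmetry of the distance one inequality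
    suffices. *)
Definition nonexpansive (f : X -> R) := forall x y, f x <= f y + mdist x y.

Lemma nonexpansive_continuous (f : X -> R) : nonexpansive f -> continuous f.
Proof.
move=> lf x; apply/cvgrPdist_lt => e e0.
near=> y.
have xy : mdist x y < e.
  near: y; apply/nbhs_ballP; exists e => //= y; by rewrite ballEmdist.
rewrite (le_lt_trans _ xy)// ler_norml; apply/andP; split.
  by have := lf y x; rewrite metric_sym; lra.
by have := lf x y; lra.
Unshelve. all: end_near.
Qed.

Lemma nonexpansive_measurable (f : X -> R) :
  nonexpansive f -> measurable_fun [set: borel X] (f : borel X -> R).
Proof. by move/nonexpansive_continuous; exact: measurable_continuous. Qed.

Lemma nonexpansive_mdist y : nonexpansive (fun x => mdist x y).
Proof. by move=> x z; rewrite addrC metric_triangle. Qed.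

Lemma nonexpansive_min (I : finType) (i0 : I) (h : I -> X -> R) :
  (forall i, nonexpansive (h i)) ->
  nonexpansive (fun x => \big[Order.min/h i0 x]_i h i x).
Proof.
move=> hl x y; rewrite -lerBlDr; apply/bigmin_geP; split => [|i _];
  rewrite lerBlDr.
- by apply: le_trans (hl i0 x y); exact: bigmin_le_id.
- by apply: le_trans (hl i x y); exact: bigmin_le.
Qed.

(** With respect to the product of the Borel sigma-algebras; this uses
    separability, through [d(x, y) = inf_k (d(x, s_k) + d(y, s_k))] for a dense
    sequence [s]. *)
Lemma measurable_mdist : measurable_fun [set: borel X * borel X]
  (fun z => mdist (z.1 : X) (z.2 : X)).
Proof.
have [s sd] := dense_sequence.
have mds k := nonexpansive_measurable (@nonexpansive_mdist (s k)).
have md k : measurable_fun [set: borel X * borel X]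
    (fun z => mdist (z.1 : X) (s k) + mdist (z.2 : X) (s k)).
  apply: measurable_funD.
    apply: (@measurableT_comp _ _ _ _ _ _
      (fun x : borel X => mdist (x : X) (s k))) => //.
  apply: (@measurableT_comp _ _ _ _ _ _
      (fun x : borel X => mdist (x : X) (s k))) => //.
apply: (measurability (@RGenInftyO.G R) (RGenInftyO.measurableE R)).
move=> _ [_ [a ->] <-]; rewrite setTI.
rewrite (_ : _ @^-1` _ = \bigcup_k [set z : borel X * borel X |
    mdist (z.1 : X) (s k) + mdist (z.2 : X) (s k) < a]).
  apply: bigcupT_measurable => k.
  have := md k measurableT `]-oo, a[%classic (measurable_itv _).
  by rewrite setTI set_itvNyo.
apply/seteqP; split => [[x y]|[x y] [k _]] /=.
  rewrite in_itv/= => xya.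
  have [|k skx] := sd x ((a - mdist x y) / 2).
    by rewrite divr_gt0// subr_gt0.
  exists k => //=.
  have := metric_triangle y x (s k); have := metric_sym (s k) x.
  have := metric_sym x y; lra.
rewrite in_itv/=; apply: le_lt_trans.
by rewrite [leRHS]addrC (metric_sym y) [leRHS]addrC; exact: metric_triangle.
Qed.

Lemma measurable_edist : measurable_fun [set: borel X * borel X]
  (fun z => (mdist (z.1 : X) (z.2 : X))%:E).
Proof. by apply/measurable_EFinP; exact: measurable_mdist. Qed.

(** Taking the last ball rather than the first makes the recursion structural in
    [N], so that measurability is an immediate induction. *)
Fixpoint last_ball (s : nat -> X) (e : R) (N : nat) (x : borel X) : nat :=
  if N is N'.+1 then
    if `[< ball (s N') e (x : X) >] then N' else last_ball s e N' x
  else 0.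

Lemma last_ball_lt s e N x : (last_ball s e N x < N.+1)%N.
Proof.
elim: N => //= N IH; case: ifPn => // _; exact: leqW.
Qed.

Lemma mem_last_ball s e N x :
  (exists2 k, (k < N)%N & ball (s k) e x) -> ball (s (last_ball s e N x)) e x.
Proof.
elim: N => [[]//|N IH [k kN kx]] /=; case: ifPn => [/asboolP//|/asboolP nx].
apply: IH; exists k => //; rewrite ltn_neqAle -ltnS kN andbT.
by apply: contraPneq nx => <-.
Qed.

Lemma measurable_last_ball s e N :
  measurable_fun [set: borel X] (last_ball s e N).
Proof.
elim: N => [|N IH] /=; first exact: measurable_cst.
apply: measurable_fun_ifT => //.
apply: (measurable_fun_bool true); rewrite setTI.
rewrite (_ : _ @^-1` _ = ball (s N) e).
  by apply: sub_sigma_algebra; exact: open_mball.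
by apply/seteqP; split => x /= /asboolP.
Qed.

(** Within the first [N] balls the displacement is at most [e / 2]; outside it is
    bounded by the diameter, and the mass outside tends to 0 with [N]. *)
Lemma last_ball_error (M : R) (s : nat -> X) (P : probability (borel X) R)
    (e : R) :
  (forall x y, mdist x y <= M) ->
  (forall x d, 0 < d -> exists k, mdist (s k) x < d) -> 0 < e ->
  \forall N \near \oo,
    (\int[P]_x (mdist (x : X) (s (last_ball s (e / 2) N x)))%:E <= e%:E)%E.
Proof.
move=> diamM sd e0; have e20 : 0 < e / 2 by rewrite divr_gt0.
(* A strictly positive bound on the diameter, to divide by. *)
pose L := `|M| + 1; have L0 : 0 < L by rewrite ltr_wpDl.
have diamL x y : mdist x y <= L.
  by rewrite (le_trans (diamM x y))// (le_trans (ler_norm _))// lerDl.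
pose U N : set (borel X) := \bigcup_(k < N) ball (s k) (e / 2).
have mU N : measurable (U N).
  apply: bigcup_measurable => k _; apply: sub_sigma_algebra; exact: open_mball.
have ndU : {homo U : n m / (n <= m)%N >-> (n <= m)%O}.
  move=> n m nm; apply/subsetPset => x [k /= kn kx]; exists k => //=.
  exact: leq_trans nm.
have UT : \bigcup_N U N = setT.
  rewrite -subTset => x _; have [k skx] := sd x _ e20.
  by exists k.+1 => //; exists k => //=; rewrite ballEmdist.
have PU : P (U N) @[N --> \oo] --> 1%E.
  rewrite -(@probability_setT _ _ _ P) -UT; apply: nondecreasing_cvg_mu => //.
  by rewrite UT.
have : \forall N \near \oo, ((1 - e / 2 / L)%:E < P (U N))%E.
  apply: (PU [set x | (_ < x)%E]); apply: open_nbhs_nbhs; split.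
    exact: open_ereal_gt_ereal.
  by rewrite /= lte_fin ltrBlDr ltrDl !divr_gt0.
apply: filterS => N PUN.
pose bound (x : borel X) : \bar R := ((e / 2)%:E + L%:E * (\1_(~` U N) x)%:E)%E.
have mUC : measurable (~` U N) by exact: measurableC.
have bound0 x : (0 <= L%:E * (\1_(~` U N) x)%:E)%E.
  by rewrite mule_ge0// lee_fin ?(ltW L0).
have mind : measurable_fun [set: borel X]
    (fun x => (\1_(~` U N) x)%:E : \bar R).
  by apply/measurable_EFinP; exact: measurable_indic.
apply: (@le_trans _ _ (\int[P]_x bound x)%E).
  apply: ge0_le_integral_nonmeasurable => [x|x]; first by rewrite lee_fin mdist_ge0.
  rewrite /bound indicE; have [Ux|Ux] := pselect (U N x); last first.
    by rewrite mem_set// -EFinM -EFinD lee_fin mulr1 ler_wpDl// ltW.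
  rewrite memNset; last by move=> /(_ Ux).
  rewrite mule0 adde0 lee_fin ltW// metric_sym.
  have : ball (s (last_ball s (e / 2) N x)) (e / 2) (x : X).
    by apply: mem_last_ball; case: Ux => k /= kN kx; exists k.
  by rewrite ballEmdist.
rewrite /bound ge0_integralD//; last 2 first.
- by move=> x _; rewrite lee_fin ltW.
- by apply: emeasurable_funM.
rewrite integral_cst// [X in (_ * X)%E](_ : _ = 1%E); last exact: probability_setT.
rewrite mule1 ge0_integralZl//; last by rewrite lee_fin ltW.
rewrite integral_indic// setIT.
rewrite [X in (_ * X)%E](_ : _ = (1 - P (U N))%E); last exact: probability_setC.
rewrite -[P (U N)]fineK ?fin_num_measure// -EFinB -EFinM -EFinD lee_fin.
move: PUN; rewrite -[P (U N)]fineK ?fin_num_measure// lte_fin => PUN.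
have : L * (1 - fine (P (U N))) <= L * (e / 2 / L).
  by rewrite ler_pM2l//; lra.
have -> : L * (e / 2 / L) = e / 2 by rewrite mulrC divfK// gt_eqF.
by lra.
Qed.

(** A single map serves both measures, so that both are transported to measures
    on the same finite set of points. *)
Lemma quantisation (M : R) (P1 P2 : probability (borel X) R) (e : R) :
  (forall x y, mdist x y <= M) -> 0 < e ->
  exists N (s : 'I_N.+1 -> X) (t : borel X -> 'I_N.+1),
    [/\ forall i, measurable (t @^-1` [set i]),
      (\int[P1]_x (mdist (x : X) (s (t x)))%:E <= e%:E)%E &
      (\int[P2]_x (mdist (x : X) (s (t x)))%:E <= e%:E)%E].
Proof.
move=> diamM e0; have [s sd] := dense_sequence.
have [N [e1 e2]] : exists N,
    (\int[P1]_x (mdist (x : X) (s (last_ball s (e / 2) N x)))%:E <= e%:E)%E /\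
    (\int[P2]_x (mdist (x : X) (s (last_ball s (e / 2) N x)))%:E <= e%:E)%E.
  apply: (@filter_ex _ \oo); apply: filterI; exact: last_ball_error diamM sd e0.
have lastE x : @inord N (last_ball s (e / 2) N x) = last_ball s (e / 2) N x :> nat.
  by rewrite inordK// last_ball_lt.
exists N, (fun i => s i), (fun x => inord (last_ball s (e / 2) N x)); split.
- move=> i; rewrite (_ : _ @^-1` _ = last_ball s (e / 2) N @^-1` [set (i : nat)]).
    by rewrite -[X in measurable X]setTI; exact: measurable_last_ball.
  apply/seteqP; split => x /= tx; first by rewrite -lastE tx.
  by apply: val_inj; rewrite /= lastE.
- by under eq_integral do rewrite lastE.
- by under eq_integral do rewrite lastE.
Qed.

End polish.

(** * Kantorovich-Rubinstein duality *)

Lemma measurable_fun_finite_range d d' (T : measurableType d)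
    (U : measurableType d') (I : finType) (t : T -> I) (h : I -> T -> U) :
  (forall i, measurable (t @^-1` [set i])) ->
  (forall i, measurable_fun setT (h i)) ->
  measurable_fun setT (fun x => h (t x) x).
Proof.
move=> mt mh _ Y mY; rewrite setTI.
rewrite (_ : _ @^-1` Y = \bigcup_i (t @^-1` [set i] `&` h i @^-1` Y)).
  apply: fin_bigcup_measurable => // i _; apply: measurableI => //.
  by rewrite -[X in measurable X]setTI; exact: mh.
by apply/seteqP; split => [x Yx|x [i _ [/= ti]]]; [exists (t x)|rewrite ti].
Qed.

Section kantorovich.
Local Open Scope ereal_scope.
Context (R : realType) (X : polishMetricType R).
Implicit Types (P : probability (borel X) R) (f : X -> R).

Lemma wasserstein_le_cost P1 P2 (g : probability (borel X * borel X)%type R) :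
  coupling P1 P2 g ->
  wasserstein P1 P2 <= \int[g]_z (mdist (z.1 : X) (z.2 : X))%:E.
Proof. by move=> gc; apply: ereal_inf_lbound; exists g. Qed.

Lemma wasserstein_ge0 P1 P2 : 0 <= wasserstein P1 P2.
Proof.
apply: le_ereal_inf_tmp => _ [g _ <-]; apply: integral_ge0 => z _.
by rewrite lee_fin mdist_ge0.
Qed.

(** The easy half of duality. The integral is required to be finite only to move
    it across the infimum defining [wasserstein]. *)
Lemma nonexpansive_integral_le P1 P2 f :
  nonexpansive f -> (forall x, 0 <= f x)%R ->
  \int[P2]_x (f x)%:E \is a fin_num ->
  \int[P1]_x (f x)%:E <= \int[P2]_x (f x)%:E + wasserstein P1 P2.
Proof.
move=> lf f0 finf; rewrite -leeBlDl//; apply: le_ereal_inf_tmp => _ [g gc <-].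
rewrite leeBlDl//.
have mf : measurable_fun [set: borel X] (fun x => (f x)%:E).
  by apply/measurable_EFinP; exact: nonexpansive_measurable.
have fe0 (x : borel X) : 0 <= (f x)%:E by rewrite lee_fin.
rewrite -(integral_coupling_fst gc mf fe0) -(integral_coupling_snd gc mf fe0).
rewrite -ge0_integralD//.
- apply: ge0_le_integral_nonmeasurable => z; first exact: fe0.
  by rewrite -EFinD lee_fin; exact: lf.
- exact: (measurableT_comp mf measurable_snd).
- by move=> z _; rewrite lee_fin mdist_ge0.
- exact: measurable_edist.
Qed.

Lemma measurable_quantisation_error (N : nat) (s : 'I_N.+1 -> X)
    (t : borel X -> 'I_N.+1) : (forall i, measurable (t @^-1` [set i])) ->
  measurable_fun [set: borel X] (fun x => (mdist (x : X) (s (t x)))%:E).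
Proof.
move=> mt.
apply: (@measurable_fun_finite_range _ _ _ _ _ t
  (fun i (x : borel X) => (mdist (x : X) (s i))%:E) mt) => i.
apply/measurable_EFinP.
exact (nonexpansive_measurable (@nonexpansive_mdist _ X (s i))).
Qed.

(** For a 1-Lipschitz [f], replacing [x] by the centre [s (t x)] of its cell
    changes the integral by at most the mean displacement. *)
Lemma integral_quantised P (N : nat) (s : 'I_N.+1 -> X)
    (t : borel X -> 'I_N.+1) f :
  (forall i, measurable (t @^-1` [set i])) -> nonexpansive f ->
  (forall x, 0 <= f x)%R ->
  let q := (\sum_i f (s i) * fine (P (t @^-1` [set i])))%:E in
  let err := \int[P]_x (mdist (x : X) (s (t x)))%:E in
  q <= \int[P]_x (f x)%:E + err /\ \int[P]_x (f x)%:E <= q + err.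
Proof.
move=> mt lf f0 q err.
have mf : measurable_fun [set: borel X] (fun x => (f x)%:E).
  by apply/measurable_EFinP; exact: nonexpansive_measurable.
have qE : q = \int[P]_x (f (s (t x)))%:E.
  rewrite (@integral_finite_range _ _ _ _ P t (fun i => (f (s i))%:E))//; last first.
    by move=> i; rewrite lee_fin.
  rewrite /q -sumEFin; apply: eq_bigr => i _.
  by rewrite EFinM fineK// fin_num_measure.
have mst : measurable_fun [set: borel X] (fun x => (f (s (t x)))%:E).
  exact: (measurable_fun_finite_range mt (fun i => measurable_cst (f (s i))%:E)).
have me := measurable_quantisation_error s mt.
have e0 (x : borel X) : setT x -> 0 <= (mdist (x : X) (s (t x)))%:E.
  by rewrite lee_fin mdist_ge0.
rewrite qE /err -!ge0_integralD//; try by move=> x _; rewrite lee_fin.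
split; apply: ge0_le_integral_nonmeasurable => x; rewrite -?EFinD lee_fin ?f0//.
by rewrite metric_sym; exact: lf.
Qed.

(** The hard half of duality. Quantise with mean displacement [e / 4]: passing
    from [P1], [P2] to the finite problem costs [e / 4] twice in the dual and
    twice in the primal. *)
Lemma kantorovich_rubinstein (M D : R) P1 P2 :
  (forall x y : X, mdist x y <= M)%R ->
  (forall f, nonexpansive f -> (forall x, 0 <= f x)%R ->
    \int[P1]_x (f x)%:E <= \int[P2]_x (f x)%:E + D%:E) ->
  wasserstein P1 P2 <= D%:E.
Proof.
move=> diamM PD; apply/lee_addgt0Pr => e e0.
have e40 : (0 < e / 4)%R by rewrite divr_gt0.
have [N [s [t [mt err1 err2]]]] := quantisation P1 P2 diamM e40.
pose a i := fine (P1 (t @^-1` [set i])).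
pose b i := fine (P2 (t @^-1` [set i])).
have aE i : (a i)%:E = P1 (t @^-1` [set i]) by rewrite fineK// fin_num_measure.
have bE i : (b i)%:E = P2 (t @^-1` [set i]) by rewrite fineK// fin_num_measure.
have a0 i : (0 <= a i)%R by rewrite fine_ge0.
have b0 i : (0 <= b i)%R by rewrite fine_ge0.
have sum_cells P : \sum_i P (t @^-1` [set i]) = 1.
  rewrite -(@probability_setT _ _ _ P).
  rewrite [RHS](@measure_finite_partition _ _ _ _ P t)//.
  by apply: eq_bigr => i _; rewrite setTI.
have a1 : (\sum_i a i = 1)%R.
  by apply: EFin_inj; rewrite -sumEFin -(sum_cells P1); apply: eq_bigr.
have b1 : (\sum_i b i = 1)%R.
  by apply: EFin_inj; rewrite -sumEFin -(sum_cells P2); apply: eq_bigr.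
have [u v uv|p [p0 pa pb pc]] := @finite_transport_duality R 'I_N.+1 a b
    (fun i j => mdist (s i) (s j)) (D + e / 4 + e / 4)%R a0 b0 a1 b1.
  (* f is the largest 1-Lipschitz function with f (s i) <= - v i; as u, v is
     dual feasible, u i <= f (s i). Subtracting m makes f nonnegative. *)
  pose h i x := (mdist x (s i) - v i)%R.
  have lh i : nonexpansive (h i).
    move=> x y; rewrite /h; have := @nonexpansive_mdist _ X (s i) x y; lra.
  pose f x := (\big[Order.min/h ord0 x]_i h i x)%R.
  have lf : nonexpansive f by exact: nonexpansive_min.
  pose m := (f (s ord0) - M)%R.
  have fm0 x : (0 <= f x - m)%R.
    have := lf (s ord0) x; have := diamM (s ord0) x; rewrite /m; lra.
  have lfm : nonexpansive (fun x => f x - m)%R.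
    by move=> x y; have := lf x y; lra.
  have fv j : (v j <= - f (s j))%R.
    rewrite lerNr; apply: le_trans (bigmin_le _ j _) _.
    by rewrite /h mdistxx sub0r.
  have uf i : (u i <= f (s i))%R.
    by apply/bigmin_geP; split => [|j _]; rewrite /h lerBrDr.
  have [q1 _] := integral_quantised P1 s mt lfm fm0.
  have [_ q2] := integral_quantised P2 s mt lfm fm0.
  have {q1}q1 := le_trans q1 (leeD (PD _ lfm fm0) err1).
  have {q2}q2 := le_trans q2 (leeD2l _ err2).
  have := le_trans q1 (leeD2r _ (leeD2r _ q2)).
  rewrite -!EFinD lee_fin.
  have shift (w : 'I_N.+1 -> R) : (\sum_i w i = 1)%R ->
      (\sum_i (f (s i) - m) * w i = \sum_i f (s i) * w i - m)%R.
    move=> w1; under eq_bigr do rewrite mulrBl.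
    by rewrite sumrB -mulr_sumr w1 mulr1.
  rewrite (shift a a1) (shift b b1).
  have : (\sum_i u i * a i <= \sum_i f (s i) * a i)%R.
    by apply: ler_sum => i _; exact: ler_wpM2r.
  have : (\sum_i v i * b i <= - \sum_i f (s i) * b i)%R.
    rewrite -sumrN; apply: ler_sum => i _; rewrite -mulNr; exact: ler_wpM2r.
  lra.
have [|j|g gc gp] := @coupling_of_cells _ _ R P1 P2 N t p mt p0.
- by move=> i; rewrite pa.
- by rewrite pb.
apply: (le_trans (wasserstein_le_cost gc)).
(* Route the cost through the two centres:
   d(x, y) <= d(x, s (t x)) + d(s (t x), s (t y)) + d(y, s (t y)). *)
pose tt (z : borel X * borel X) := (t z.1, t z.2).
have mtt ij : measurable (tt @^-1` [set ij]).
  case: ij => i j; rewrite (_ : _ @^-1` _ = (t @^-1` [set i]) `*` (t @^-1` [set j])).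
    exact: measurableX.
  by apply/seteqP; split => [[x y] [<- <-]|[x y] [/= <- <-]].
pose c (ij : 'I_N.+1 * 'I_N.+1) := (mdist (s ij.1) (s ij.2))%:E.
pose err (x : borel X) := (mdist (x : X) (s (t x)))%:E.
have merr : measurable_fun setT err by exact: measurable_quantisation_error.
have err0 x : 0 <= err x by rewrite lee_fin mdist_ge0.
have mc : measurable_fun setT (fun z => c (tt z)).
  exact: (measurable_fun_finite_range mtt (fun ij => measurable_cst (c ij))).
have c0 z : 0 <= c (tt z) by rewrite lee_fin mdist_ge0.
apply: (@le_trans _ _ (\int[g]_z (err z.1 + (c (tt z) + err z.2)))).
  apply: ge0_le_integral_nonmeasurable => [z|[x y]].
    by rewrite lee_fin mdist_ge0.
  rewrite /err /c /= -!EFinD lee_fin.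
  have := metric_triangle (x : X) (s (t x)) (y : X).
  have := metric_triangle (s (t x)) (s (t y)) (y : X).
  have := metric_sym (s (t y)) (y : X); lra.
rewrite ge0_integralD//; last 3 first.
- exact: (measurableT_comp merr measurable_fst).
- by move=> z _; rewrite adde_ge0.
- by apply: emeasurable_funD => //; exact: (measurableT_comp merr measurable_snd).
rewrite ge0_integralD//; last exact: (measurableT_comp merr measurable_snd).
rewrite (integral_coupling_fst gc merr)// (integral_coupling_snd gc merr)//.
rewrite (integral_finite_range _ mtt); last by move=> ij; rewrite lee_fin mdist_ge0.
have -> : \sum_ij c ij * g (tt @^-1` [set ij]) =
    (\sum_i \sum_j mdist (s i) (s j) * p i j)%:E.
  rewrite pair_big/= -sumEFin; apply: eq_bigr => -[i j] _ /=.
  rewrite EFinM -gp; congr (_ * g _).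
  by apply/seteqP; split => [[x y] [<- <-]|[x y] [/= <- <-]].
apply: (@le_trans _ _ ((e / 4)%:E + ((D + e / 4 + e / 4)%:E + (e / 4)%:E))).
  by rewrite leeD// leeD// lee_fin.
rewrite -!EFinD lee_fin; lra.
Qed.

End kantorovich.

(** * Independent copies *)

Section product_law.
Local Open Scope ereal_scope.
Context (R : realType).

(** The joint law is the [n]-th power of [P], tested on boxes. Unlike [iid] this
    is a single product formula over all indices, which is the form needed to
    identify a joint law through a pi-system. *)
Definition joint_law_is_power d (T : measurableType d) d' (O : measurableType d')
    (mu : probability O R) (n : nat) (Z : 'I_n -> {RV mu >-> T})
    (P : probability T R) :=
  forall A : 'I_n -> set T, (forall i, measurable (A i)) ->
    mu (\bigcap_i (Z i @^-1` A i)) = \prod_i P (A i).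

Lemma iid_joint_law d (T : measurableType d) d' (O : measurableType d')
    (mu : probability O R) (n : nat) (Z : 'I_n -> {RV mu >-> T})
    (P : probability T R) : iid Z P -> joint_law_is_power Z P.
Proof.
move=> [indep law] A mA; have := indep [set: 'I_n]%SET A mA.
rewrite (_ : [set` _] = setT).
  move=> ->; apply: eq_big => [i|i _]; first by rewrite inE.
  exact: law.
by apply/seteqP; split => i //= _; rewrite inE.
Qed.

(** The sample space is built by adding one factor at a time; the new
    coordinate is the first projection. *)
Lemma independent_copies d (T : measurableType d) (P : probability T R) (n : nat) :
  exists d' (O : measurableType d') (mu : probability O R)
    (Z : 'I_n -> {RV mu >-> T}), joint_law_is_power Z P.
Proof.
elim: n => [|n [dO [ O [mu [Z ZP]]]]].
  have z : 'I_0 -> {RV P >-> T} by case.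
  exists d, T, P, z => A mA; rewrite big_ord0.
  rewrite (_ : \bigcap_i _ = setT) ?probability_setT//.
  by apply/seteqP; split => // x _ [].
have [nu nuE] : exists nu : probability (T * O)%type R,
    nu = (P \x mu)%E :> (set (T * O) -> \bar R).
  apply: measure_is_probability.
  rewrite -setXTT.
  transitivity (P setT * mu setT); first exact: product_measure1E.
  by rewrite !probability_setT mule1.
pose Z' (i : 'I_n.+1) (w : T * O) : T :=
  if unlift ord0 i is Some j then Z j w.2 else w.1.
have mZ' i : measurable_fun setT (Z' i).
  rewrite /Z'; case: unliftP => [j _|_]; last exact: measurable_fst.
  exact: (measurableT_comp (measurable_funP (Z j)) measurable_snd).
pose RV' i : {RV nu >-> T} := mfun_Sub (mem_set (mZ' i)).
exists (measure_prod_display (d, dO)), (T * O)%type, nu, RV' => A mA.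
have -> : \bigcap_i (Z' i @^-1` A i) =
    A ord0 `*` \bigcap_i (Z i @^-1` A (lift ord0 i)).
  apply/seteqP; split => [[x w] xwA|[x w] [/= Ax wA] i _].
    split => /= [|i _]; first by have := xwA ord0 I; rewrite /= /Z' unlift_none.
    by have := xwA (lift ord0 i) I; rewrite /= /Z' liftK.
  rewrite /= /Z'; case: unliftP => [j ->|->] //; exact: (wA j I).
rewrite nuE product_measure1E//; last first.
  apply: fin_bigcap_measurable => // i _.
  by rewrite -[X in measurable X]setTI; exact: measurable_funP.
by rewrite big_ord_recl; congr (_ * _); exact: (ZP (fun i => A (lift ord0 i))).
Qed.

(** Boxes form a pi-system generating the product sigma-algebra. *)
Lemma joint_law_unique d (T : measurableType d) (P : probability T R) (n : nat)
    d1 (O1 : measurableType d1) (mu1 : probability O1 R)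
    (Z1 : 'I_n -> {RV mu1 >-> T})
    d2 (O2 : measurableType d2) (mu2 : probability O2 R)
    (Z2 : 'I_n -> {RV mu2 >-> T})
    (B : set (n.-tuple T)) :
  joint_law_is_power Z1 P -> joint_law_is_power Z2 P -> measurable B ->
  mu1 ((fun w => [tuple Z1 i w | i < n]) @^-1` B) =
  mu2 ((fun w => [tuple Z2 i w | i < n]) @^-1` B).
Proof.
move=> Z1P Z2P mB.
pose box (A : 'I_n -> set T) := [set v : n.-tuple T | forall i, A i (tnth v i)].
pose G := [set box A | A in [set A | forall i, measurable (A i)]].
have mt d' (O : measurableType d') (mu : probability O R) (Z : 'I_n -> {RV mu >-> T}) :
    measurable_fun [set: O] (fun w => [tuple Z i w | i < n]).
  apply/measurable_fun_tnthP => i.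
  rewrite (_ : _ \o _ = Z i); first exact: measurable_funP.
  by apply/funext => w /=; rewrite tnth_mktuple.
pose t1 : {mfun O1 >-> n.-tuple T} := mfun_Sub (mem_set (mt _ _ _ Z1)).
pose t2 : {mfun O2 >-> n.-tuple T} := mfun_Sub (mem_set (mt _ _ _ Z2)).
have mG : G `<=` measurable.
  move=> _ [A mA <-].
  rewrite (_ : box A = \bigcap_i ((@tnth n T)^~ i @^-1` A i)).
    apply: fin_bigcap_measurable => // i _.
    by rewrite -[X in measurable X]setTI; exact: measurable_tnth.
  by apply/seteqP; split => v vA => [i _|i]; exact: vA.
have GT : G setT.
  by exists (fun=> setT) => //; apply/seteqP; split.
apply: (@g_sigma_algebra_measure_unique _ R _ G mG (fun=> setT) (fun=> GT) _
  (distribution mu1 t1) (distribution mu2 t2)).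
- by apply/seteqP; split => // v _; exists 0%N.
- move=> _ _ [A1 mA1 <-] [A2 mA2 <-]; exists (fun i => A1 i `&` A2 i).
    by move=> i; exact: measurableI.
  by apply/seteqP; split => v => [vA|[v1 v2] i]; [split => i; have [] := vA i|].
- move=> _ [A mA <-].
  rewrite [LHS](_ : _ = mu1 (\bigcap_i (Z1 i @^-1` A i))).
    rewrite [RHS](_ : _ = mu2 (\bigcap_i (Z2 i @^-1` A i))); first by rewrite Z1P// Z2P.
    congr (mu2 _); apply/seteqP; split => w wA => [i _|i].
      by have := wA i; rewrite /= tnth_mktuple.
    by rewrite /= tnth_mktuple; exact: wA.
  congr (mu1 _); apply/seteqP; split => w wA => [i _|i].
    by have := wA i; rewrite /= tnth_mktuple.
  by rewrite /= tnth_mktuple; exact: wA.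
- by move=> k; rewrite (le_lt_trans (probability_le1 _ _))// ltry.
move: mB; apply: sub_sigma_algebra2.
move=> C; rewrite -bigcup_seq => -[i /= _ [A mA <-]].
exists (fun j => if j == i then A else setT) => [j|]; first by case: ifP.
rewrite setTI; apply/seteqP; split => v => [/(_ i)|vA j]; first by rewrite eqxx.
by case: eqP => // ->.
Qed.

End product_law.

(** * Upper bound *)

Section laws.
Local Open Scope ereal_scope.
Context (R : realType) d (T : measurableType d) d' (O : measurableType d').
Context (mu : probability O R) (P : probability T R).

Lemma joint_law_marginal n (Z : 'I_n -> {RV mu >-> T}) i :
  joint_law_is_power Z P -> has_law (Z i) P.
Proof.
move=> ZP A mA.
have := ZP (fun j => if j == i then A else setT).
rewrite (bigD1 i)//= big1 => [|j ji]; last by rewrite (negbTE ji) probability_setT.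
rewrite eqxx mule1 => <- => [|j]; last by case: ifP.
congr (mu _); apply/seteqP; split => w /= => [wA j _|/(_ i I)]; last by rewrite eqxx.
by case: eqP => // ->.
Qed.

Lemma has_law_integral (Z : {RV mu >-> T}) (f : T -> \bar R) :
  has_law Z P -> measurable_fun setT f -> (forall x, 0 <= f x) ->
  \int[mu]_w f (Z w) = \int[P]_x f x.
Proof.
move=> ZP mf f0; rewrite -[LHS](ge0_integral_distribution Z mf f0).
by apply: eq_measure_integral => A mA _; exact: ZP.
Qed.

End laws.

Section empirical_laws.
Local Open Scope ereal_scope.
Context (R : realType) (X : polishMetricType R).
Context (n : nat) (n_gt0 : (0 < n)%N).

(** An empirical measure is a measurable function of the tuple of observations,
    so its law depends on the joint law only. *)
Lemma empirical_law_unique (P : probability (borel X) R)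
    d1 (O1 : measurableType d1) (mu1 : probability O1 R)
    (Z1 : 'I_n -> {RV mu1 >-> borel X})
    d2 (O2 : measurableType d2) (mu2 : probability O2 R)
    (Z2 : 'I_n -> {RV mu2 >-> borel X}) (A : set (borel (prob X))) :
  joint_law_is_power Z1 P -> joint_law_is_power Z2 P -> measurable A ->
  empirical_law n_gt0 Z1 A = empirical_law n_gt0 Z2 A.
Proof.
move=> Z1P Z2P mA.
pose V := n.-tuple (borel X).
(* The measurability of empirical measures is stated for random variables, hence
   the coordinates of V are seen as such; the law put on V is arbitrary. *)
pose c i : {RV (dirac (point : V) : probability V R) >-> borel X} :=
  mfun_Sub (mem_set (@measurable_tnth _ (borel X) n i)).
pose B : set V := empirical_rv n_gt0 c @^-1` A.
have mB : measurable B.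
  by rewrite -[X in measurable X]setTI; exact: measurable_empirical_rv.
have lawE d (O : measurableType d) (mu : probability O R)
    (Z : 'I_n -> {RV mu >-> borel X}) :
    empirical_law n_gt0 Z A = mu ((fun w => [tuple Z i w | i < n]) @^-1` B).
  rewrite /empirical_law /distribution /pushforward /B; congr (mu _).
  apply/funext => w; congr A; rewrite /= /empirical_rv; congr empirical.
  by apply/funext => i /=; rewrite tnth_mktuple.
by rewrite !lawE; exact: joint_law_unique Z1P Z2P mB.
Qed.

Lemma average_const (k : \bar R) : (n%:R^-1)%:E * \sum_(i < n) k = k.
Proof.
rewrite sumr_const card_ord.
have -> : (k *+ n)%R = n%:R%:E * k by exact/esym/mule_natl.
by rewrite muleA -EFinM mulVf ?mul1e// pnatr_eq0 -lt0n.
Qed.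

(** The uniform mixture of the Dirac masses at [(x i, y i)] is a coupling. *)
Lemma wasserstein_empirical_le (x y : 'I_n -> borel X) :
  wasserstein (empirical n_gt0 x) (empirical n_gt0 y) <=
  (n%:R^-1)%:E * \sum_(i < n) (mdist (x i : X) (y i : X))%:E.
Proof.
have n1 : (0 <= n%:R^-1 :> R)%R by rewrite invr_ge0.
pose z k : borel X * borel X :=
  (x (insubd (Ordinal n_gt0) k), y (insubd (Ordinal n_gt0) k)).
have zE (i : 'I_n) : z i = (x i, y i).
  have iE : insubd (Ordinal n_gt0) (i : nat) = i.
    by apply: val_inj; rewrite val_insubd ltn_ord.
  by rewrite /z iE.
pose m : {measure set (borel X * borel X) -> \bar R} :=
  mscale (NngNum n1) (msum (fun k => dirac (z k)) n).
have mE A : m A = (n%:R^-1)%:E * \sum_(i < n) \d_(x i, y i) A.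
  by rewrite /m/= /mscale/= /msum/=; congr (_ * _); apply: eq_bigr => i _; rewrite zE.
have [g gE] : exists g : probability (borel X * borel X)%type R,
    g = m :> (set (borel X * borel X) -> \bar R).
  apply: measure_is_probability; rewrite mE.
  rewrite (eq_bigr (fun=> 1)) => [|i _]; last exact: diracT.
  rewrite sumEFin sumr_const card_ord -EFinM -mulr_natr mul1r mulVf//.
  by rewrite pnatr_eq0 -lt0n.
have gc : coupling (empirical n_gt0 x) (empirical n_gt0 y) g.
  split => A mA; rewrite gE mE /= /empirical; congr (_ * _);
    by apply: eq_bigr => i _; rewrite /dirac/= !indicE.
apply: (le_trans (wasserstein_le_cost gc)).
rewrite (@eq_measure_integral _ _ _ _ m); last by move=> A mA _; rewrite -gE.
have d0 (w : borel X * borel X) : setT w -> 0 <= (mdist (w.1 : X) (w.2 : X))%:E.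
  by rewrite lee_fin mdist_ge0.
rewrite ge0_integral_mscale//; last exact: measurable_edist.
rewrite ge0_integral_measure_sum//; last exact: measurable_edist.
rewrite le_eqVlt; apply/orP; left; apply/eqP; congr (_ * _).
apply: eq_bigr => i _; rewrite integral_dirac//; last exact: measurable_edist.
by rewrite diracT mul1e zE.
Qed.

Lemma wow_empirical_le (P1 P2 : probability (borel X) R)
    d1 (O1 : measurableType d1) (mu1 : probability O1 R)
    (Xs : 'I_n -> {RV mu1 >-> borel X})
    d2 (O2 : measurableType d2) (mu2 : probability O2 R)
    (Ys : 'I_n -> {RV mu2 >-> borel X}) :
  joint_law_is_power Xs P1 -> joint_law_is_power Ys P2 ->
  wasserstein_over_wasserstein (empirical_law n_gt0 Xs) (empirical_law n_gt0 Ys)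
  <= wasserstein P1 P2.
Proof.
move=> XP YP; apply: le_ereal_inf_tmp => _ [g gc <-].
have [dO [ O [mu [Z Zg]]]] := independent_copies g n.
have mX i : measurable_fun [set: O] (fun w => (Z i w).1).
  exact: (measurableT_comp measurable_fst (measurable_funP (Z i))).
have mY i : measurable_fun [set: O] (fun w => (Z i w).2).
  exact: (measurableT_comp measurable_snd (measurable_funP (Z i))).
pose X' i : {RV mu >-> borel X} := mfun_Sub (mem_set (mX i)).
pose Y' i : {RV mu >-> borel X} := mfun_Sub (mem_set (mY i)).
have X'P : joint_law_is_power X' P1.
  move=> A mA; rewrite -(eq_bigr _ (fun i _ => gc.1 (A i) (mA i))).
  rewrite -Zg// => i; rewrite -[X in measurable X]setTI; exact: measurable_fst.
have Y'P : joint_law_is_power Y' P2.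
  move=> A mA; rewrite -(eq_bigr _ (fun i _ => gc.2 (A i) (mA i))).
  rewrite -Zg// => i; rewrite -[X in measurable X]setTI; exact: measurable_snd.
pose phi w : borel (prob X) * borel (prob X) :=
  (empirical_rv n_gt0 X' w, empirical_rv n_gt0 Y' w).
have mphi : measurable_fun [set: O] phi.
  by apply: measurable_fun_pair; exact: measurable_empirical_rv.
pose Phi : {mfun O >-> (borel (prob X) * borel (prob X))%type} :=
  mfun_Sub (mem_set mphi).
apply: (@le_trans _ _
  (\int[distribution mu Phi]_z wasserstein z.1 z.2)).
  apply: ereal_inf_lbound; exists (distribution mu Phi) => //.
  split => A mA.
    exact: (empirical_law_unique X'P XP mA).
  exact: (empirical_law_unique Y'P YP mA).
apply: (le_trans (le_integral_pushforward mphi mu _)) => [z|].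
  exact: wasserstein_ge0.
have mdZ i : measurable_fun [set: O] (fun w => (mdist ((Z i w).1 : X) (Z i w).2)%:E).
  exact (measurableT_comp (@measurable_edist R X) (measurable_funP (Z i))).
apply: (@le_trans _ _ (\int[mu]_w ((n%:R^-1)%:E *
    \sum_(i < n) (mdist ((Z i w).1 : X) (Z i w).2)%:E))).
  apply: ge0_le_integral_nonmeasurable => w; first exact: wasserstein_ge0.
  exact: wasserstein_empirical_le.
have dZ0 i w : [set: O] w -> 0 <= (mdist ((Z i w).1 : X) (Z i w).2)%:E.
  by rewrite lee_fin mdist_ge0.
rewrite ge0_integralZl//; last 2 first.
- by apply: emeasurable_sum => i; exact: mdZ.
- by move=> w _; apply: sume_ge0 => i _; exact: dZ0.
rewrite ge0_integral_sum//.
rewrite (eq_bigr (fun=> \int[g]_z (mdist (z.1 : X) (z.2 : X))%:E)) => [|i _]; last first.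
  apply: (@has_law_integral _ _ _ _ _ _ _ (Z i) (fun z => (mdist (z.1 : X) (z.2 : X))%:E)).
  - exact: joint_law_marginal.
  - exact: measurable_edist.
  - by move=> z; rewrite lee_fin mdist_ge0.
by rewrite average_const.
Qed.

End empirical_laws.

(** * Lower bound *)

Section lower.
Local Open Scope ereal_scope.
Context (R : realType) (X : polishMetricType R).

(** Evaluation at [f] is continuous for the weak topology. *)
Lemma measurable_test_integral (f : bounded_continuous X) :
  measurable_fun [set: borel (prob X)] (fun p : borel (prob X) => test_integral p f).
Proof.
have cf : continuous (fun p : prob X => test_integral p f : R).
  move=> p; apply: (@continuous_comp _ _ _ (@test_integral R X : prob X -> _)
    (@proj {classic bounded_continuous X} (fun=> R) f)).
    exact: initial_continuous.
  exact: proj_continuous.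
apply: (measurability (@RGenOInfty.G R) (RGenOInfty.measurableE R)).
move=> _ [_ [a ->] <-]; rewrite setTI; apply: sub_sigma_algebra.
by move/continuousP : cf; apply; rewrite set_itvoy; exact: open_gt.
Qed.

(** The mean of the random empirical measure is the common law of the sample,
    by linearity of the integral over the [n] observations. *)
Lemma integral_empirical_law (P : probability (borel X) R) (n : nat)
    (n_gt0 : (0 < n)%N) d (O : measurableType d) (mu : probability O R)
    (Z : 'I_n -> {RV mu >-> borel X}) (f : borel X -> \bar R) :
  (forall i, has_law (Z i) P) -> measurable_fun setT f -> (forall x, 0 <= f x) ->
  measurable_fun [set: borel (prob X)]
    (fun p : borel (prob X) => \int[(p : probability (borel X) R)]_x f x) ->
  \int[empirical_law n_gt0 Z]_p (\int[(p : probability (borel X) R)]_x f x) =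
  \int[P]_x f x.
Proof.
move=> ZP mf f0 mF.
rewrite [LHS](ge0_integral_pushforward (measurable_empirical_rv n_gt0 Z))//; last first.
  by move=> p _; exact: integral_ge0.
rewrite preimage_setT.
transitivity (\int[mu]_w ((n%:R^-1)%:E * \sum_(i < n) f (Z i w))).
  by apply: eq_integral => w _; exact: ge0_integral_empirical.
have mfZ i : measurable_fun [set: O] (fun w => f (Z i w)).
  exact: (measurableT_comp mf (measurable_funP (Z i))).
rewrite ge0_integralZl//; last 2 first.
- by apply: emeasurable_sum => i; exact: mfZ.
- by move=> w _; exact: sume_ge0.
rewrite ge0_integral_sum// (eq_bigr (fun=> \int[P]_x f x)) => [|i _]; last first.
  exact: has_law_integral.
exact: average_const.
Qed.

Lemma wasserstein_le_wow (M : R) (P1 P2 : probability (borel X) R) (n : nat)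
    (n_gt0 : (0 < n)%N)
    d1 (O1 : measurableType d1) (mu1 : probability O1 R)
    (Xs : 'I_n -> {RV mu1 >-> borel X})
    d2 (O2 : measurableType d2) (mu2 : probability O2 R)
    (Ys : 'I_n -> {RV mu2 >-> borel X}) :
  (forall x y : X, mdist x y <= M)%R ->
  (forall i, has_law (Xs i) P1) -> (forall i, has_law (Ys i) P2) ->
  wasserstein P1 P2 <=
  wasserstein_over_wasserstein (empirical_law n_gt0 Xs) (empirical_law n_gt0 Ys).
Proof.
move=> diamM XP YP; apply: le_ereal_inf_tmp => _ [G Gc <-].
have : 0 <= \int[G]_z wasserstein z.1 z.2.
  by apply: integral_ge0 => z _; exact: wasserstein_ge0.
case D : (\int[G]_z wasserstein z.1 z.2) => [r| |]// _; last exact: leey.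
apply: (kantorovich_rubinstein diamM) => f lf f0; rewrite -D.
have mf : measurable_fun [set: borel X] (fun x => (f x)%:E).
  by apply/measurable_EFinP; exact: nonexpansive_measurable.
pose c := (f point + M)%R.
have fc x : (f x <= c)%R.
  by rewrite (le_trans (lf x point))// lerD2l.
have bf : bounded_fun (f : X -> R^o).
  exists c; split; first exact: num_real.
  by move=> e ce x _ /=; rewrite ger0_norm// (le_trans (fc x))// ltW.
pose bcf : bounded_continuous X := exist _ f (conj (nonexpansive_continuous lf) bf).
pose h (p : borel (prob X)) : R := test_integral p bcf.
have finf (p : probability (borel X) R) : \int[p]_x (f x)%:E \is a fin_num.
  rewrite ge0_fin_numE; last by apply: integral_ge0 => x _; rewrite lee_fin.
  apply: (@le_lt_trans _ _ (\int[p]_x (cst c%:E) x)); last first.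
    by rewrite integral_cst// [X in _ * X](_ : _ = 1) ?mule1 ?ltry//; exact: probability_setT.
  apply: ge0_le_integral_nonmeasurable => x; by rewrite lee_fin.
have hE (p : borel (prob X)) : \int[(p : probability (borel X) R)]_x (f x)%:E = (h p)%:E.
  by rewrite /h /test_integral/= /Rintegral fineK//; exact: finf.
have mh : measurable_fun [set: borel (prob X)] (fun p => (h p)%:E).
  by apply/measurable_EFinP; exact: measurable_test_integral.
have h0 p : 0 <= (h p)%:E by rewrite -hE; apply: integral_ge0 => x _; rewrite lee_fin.
have lawE (P : probability (borel X) R) d (O : measurableType d)
    (mu : probability O R) (Z : 'I_n -> {RV mu >-> borel X}) :
    (forall i, has_law (Z i) P) ->
    \int[P]_x (f x)%:E = \int[empirical_law n_gt0 Z]_p (h p)%:E.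
  move=> ZP; rewrite -(@integral_empirical_law P n n_gt0 _ _ _ Z (fun x => (f x)%:E) ZP)//.
    by apply: eq_integral => p _; exact: hE.
  by under eq_fun do rewrite hE.
rewrite (lawE P1 _ _ _ Xs XP) (lawE P2 _ _ _ Ys YP).
rewrite -(integral_coupling_fst Gc mh h0) -(integral_coupling_snd Gc mh h0).
(* The positive part k of the difference is measurable and below W, so the
   integral can be split with k in place of W. *)
pose k (z : borel (prob X) * borel (prob X)) := maxe ((h z.1)%:E - (h z.2)%:E) 0.
have mh1 : measurable_fun setT (fun z : borel (prob X) * borel (prob X) => (h z.1)%:E).
  exact: (measurableT_comp mh measurable_fst).
have mh2 : measurable_fun setT (fun z : borel (prob X) * borel (prob X) => (h z.2)%:E).
  exact: (measurableT_comp mh measurable_snd).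
have mk : measurable_fun setT k.
  apply: measurable_maxe => //; exact: emeasurable_funB.
have k0 z : 0 <= k z by rewrite le_max lexx orbT.
apply: (@le_trans _ _ (\int[G]_z ((h z.2)%:E + k z))).
  apply: ge0_le_integral_nonmeasurable => z; first exact: h0.
  by rewrite -leeBlDl// le_max lexx.
rewrite ge0_integralD// leeD2l//; apply: ge0_le_integral_nonmeasurable => // z.
rewrite ge_max wasserstein_ge0 andbT leeBlDl// -!hE.
exact: nonexpansive_integral_le.
Qed.

End lower.

Theorem corollary3p6 (R : realType) (X : polishMetricType R)
  (diamX : exists M : R, forall x y : X, mdist x y <= M)
  (P1 P2 : probability (borel X) R) (n : nat) (n_gt0 : (0 < n)%N)
  (d1 : measure_display) (O1 : measurableType d1) (mu1 : probability O1 R)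
  (Xs : 'I_n -> {RV mu1 >-> borel X})
  (d2 : measure_display) (O2 : measurableType d2) (mu2 : probability O2 R)
  (Ys : 'I_n -> {RV mu2 >-> borel X})
  (iidX : iid Xs P1) (iidY : iid Ys P2) :
  wasserstein_over_wasserstein (empirical_law n_gt0 Xs) (empirical_law n_gt0 Ys)
  = wasserstein P1 P2.
Proof.
have [M diamM] := diamX.
apply/le_anti/andP; split.
  by apply: wow_empirical_le; exact: iid_joint_law.
by apply: (wasserstein_le_wow n_gt0 diamM); [case: iidX|case: iidY].
Qed.
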